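(* Let $m_1,\ldots,m_\ell\ge3$ be integers, $m:=m_1+\ldots+m_\ell$, and $C:=\prod_{i=1}^\ell\mathcal{Q}_{m_i}$ a product of second-order cones. Let $f_0\colon\mathbb{R}^n\to\mathbb{R}$ and $F=(F_1,\ldots,F_\ell)\colon\mathbb{R}^n\to\mathbb{R}^m$ with $F_i\colon\mathbb{R}^n\to\mathbb{R}^{m_i}$ be twice continuously differentiable, and consider the problem $\min\{f_0(x)\mid F(x)\in C\}$. Let $\bar x\in\mathbb{R}^n$ be feasible. Assume that for each $u\in\mathcal{C}(\bar x)\setminus\{0\}$ there are $\alpha\ge0$ and multipliers $\lambda_i\in N_{\mathcal{Q}_{m_i}}(F_i(\bar x))\cap\{\nabla F_i(\bar x)u\}^\perp$, $i=1,\ldots,\ell$, such that $$0=\alpha\nabla f_0(\bar x)+\sum_{i=1}^\ell\nabla F_i(\bar x)^\top\lambda_i,$$ $$0<\Bigl(\alpha\nabla^2f_0(\bar x)+\sum_{i=1}^\ell\sum_{j=1}^{m_i}(\lambda_i)_j\nabla^2(F_i)_j(\bar x)\Bigr)(u,u)+\sum_{i\in\mathcal{I}(\bar x)}\frac{\|\lambda_i\|}{\|F_i(\bar x)\|}\Bigl(|||\nabla F_i(\bar x)u|||^2-(\nabla F_i(\bar x)u)_1^2\Bigr),$$ where $\mathcal{I}(\bar x):=\{i\in\{1,\ldots,\ell\}\mid F_i(\bar x)\in\operatorname{bdry}\mathcal{Q}_{m_i}\setminus\{0\}\}$. Then $\bar x$ is an essential local minimizer of second order for this problem.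
   Context: For an integer $s\ge3$, $\mathcal{Q}_s:=\{y\in\mathbb{R}^s\mid(y_2^2+\ldots+y_s^2)^{1/2}\le y_1\}$, and for $v\in\mathbb{R}^s$, $|||v|||:=(v_2^2+\ldots+v_s^2)^{1/2}$. $\|\cdot\|$ is the Euclidean norm, $A(u,u):=u^\top Au$ for a symmetric matrix $A$, and $\{w\}^\perp:=\{z\mid\langle z,w\rangle=0\}$. $N_{\mathcal{Q}_s}(y):=\{y^*\mid\langle y^*,y'-y\rangle\le0\ \forall y'\in\mathcal{Q}_s\}$ is the normal cone of convex analysis, and $T_C(\bar y):=\{v\mid\exists t_k\downarrow0,\,v_k\to v\colon\bar y+t_kv_k\in C\ \forall k\}$ the tangent cone. The critical cone is $\mathcal{C}(\bar x):=\{u\in\mathbb{R}^n\mid\nabla F(\bar x)u\in T_C(F(\bar x)),\ \langle\nabla f_0(\bar x),u\rangle\le0\}$. A point $\bar x$ is an essential local minimizer of second order for $\min\{f_0(x)\mid F(x)\in C\}$ if $F(\bar x)\in C$ and there exist $\varepsilon>0$ and $\delta>0$ such that $\max\{f_0(x)-f_0(\bar x),\operatorname{dist}(F(x),C)\}\ge\varepsilon\|x-\bar x\|^2$ for all $x$ with $\|x-\bar x\|\le\delta$. *)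

(* Defs.v *)
From HB Require Import structures.
From mathcomp Require Import all_boot all_order all_algebra.
From mathcomp Require Import all_classical all_reals all_analysis.

Set Implicit Arguments.
Unset Strict Implicit.
Unset Printing Implicit Defensive.

Import Order.TTheory GRing.Theory Num.Theory.
Import numFieldNormedType.Exports.

Local Open Scope classical_set_scope.
Local Open Scope ring_scope.

(* Vectors are row vectors and the library Jacobian 'J F x is the transpose
   of the usual one: nabla F(x) u is u *m 'J F x.  The library norm `|x| on
   'rV[R]_n is the max norm, hence the separate Euclidean norm; the two induce
   the same topology. *)

Section Euclidean.
Context {R : realType}.

Definition dot n (u v : 'rV[R]_n) : R := \sum_(j < n) u 0 j * v 0 j.

Definition enorm n (u : 'rV[R]_n) : R := Num.sqrt (\sum_(j < n) u 0 j ^+ 2).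

Definition dist_set n (y : 'rV[R]_n) (C : set 'rV[R]_n) : R :=
  inf [set enorm (y - c) | c in C].

Definition quad n (A : 'M[R]_n) (u : 'rV[R]_n) : R := (u *m A *m u^T) 0 0.

End Euclidean.

Section Smoothness.
Context {R : realType} {n : nat}.

Definition grad (f : 'rV[R]_n -> R) (x : 'rV[R]_n) : 'rV[R]_n :=
  \row_(j < n) 'D_(delta_mx 0 j) f x.

Definition hess (f : 'rV[R]_n -> R) (x : 'rV[R]_n) : 'M[R]_n := 'J (grad f) x.

Definition C2 (f : 'rV[R]_n -> R) : Prop :=
  [/\ forall x, differentiable f x,
      forall x, differentiable (grad f) x
    & continuous (hess f)].

End Smoothness.

Section Cones.
Context {R : realType}.

Definition normal_cone n (C : set 'rV[R]_n) (y : 'rV[R]_n) : set 'rV[R]_n :=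
  [set ys | forall y', C y' -> dot ys (y' - y) <= 0].

Definition tangent_cone n (C : set 'rV[R]_n) (y : 'rV[R]_n) : set 'rV[R]_n :=
  [set v | exists (t : nat -> R) (w : nat -> 'rV[R]_n),
    [/\ forall k, 0 < t k, t @ \oo --> (0 : R), w @ \oo --> v
      & forall k, C (y + t k *: w k)]].

Definition orth n (w : 'rV[R]_n) : set 'rV[R]_n := [set z | dot z w = 0].

Definition bdry n (C : set 'rV[R]_n) : set 'rV[R]_n := closure C `\` interior C.

(* y_1; the default value 0 is only reached for s = 0. *)
Definition coord1 s (y : 'rV[R]_s) : R := head 0 [seq y 0 j | j : 'I_s].

Lemma coord1E s (y : 'rV[R]_s.+1) : coord1 y = y 0 ord0.
Proof. by rewrite /coord1 /image_mem enum_ordSl. Qed.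

Definition tail_norm s (y : 'rV[R]_s) : R :=
  Num.sqrt (\sum_(j < s | (0 < j)%N) y 0 j ^+ 2).

Definition soc s : set 'rV[R]_s := [set y | tail_norm y <= coord1 y].

Definition soc_prod l (m : 'I_l -> nat) : set 'rV[R]_(\sum_i m i) :=
  [set y | forall i, soc (submxrow y i)].

End Cones.

Arguments soc {R} s.
Arguments soc_prod {R l} m.

Section Problem.
Context {R : realType} {n N : nat}.

Definition critical_cone (f0 : 'rV[R]_n -> R) (F : 'rV[R]_n -> 'rV[R]_N)
    (C : set 'rV[R]_N) (xbar : 'rV[R]_n) : set 'rV[R]_n :=
  [set u | tangent_cone C (F xbar) (u *m 'J F xbar) /\ dot (grad f0 xbar) u <= 0].

Definition essential_local_min2 (f0 : 'rV[R]_n -> R) (F : 'rV[R]_n -> 'rV[R]_N)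
    (C : set 'rV[R]_N) (xbar : 'rV[R]_n) : Prop :=
  C (F xbar) /\
  exists e d : R, [/\ 0 < e, 0 < d
    & forall x, enorm (x - xbar) <= d ->
      e * enorm (x - xbar) ^+ 2 <=
        Num.max (f0 x - f0 xbar) (dist_set (F x) C)].

End Problem.

Definition stack {R : realType} {n l : nat} {m : 'I_l -> nat}
    (F : forall i, 'rV[R]_n -> 'rV[R]_(m i)) (x : 'rV[R]_n) :
    'rV[R]_(\sum_i m i) :=
  \mxrow_i F i x.

(* Main.v *)
Require Import Defs.
From HB Require Import structures.
From mathcomp Require Import all_boot all_order all_algebra.
From mathcomp Require Import all_classical all_reals all_analysis.
From mathcomp Require Import ring lra.

Set Implicit Arguments.
Unset Strict Implicit.
Unset Printing Implicit Defensive.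

Import Order.TTheory GRing.Theory Num.Theory.
Import numFieldNormedType.Exports.

Local Open Scope classical_set_scope.
Local Open Scope ring_scope.

(** The conclusion is proved by contradiction. If [xbar] is not an essential
local minimizer of second order, there are points [x_k = xbar + t_k v_k] with
[t_k > 0] tending to zero and unit vectors [v_k], and points [y_k] of the product
of cones, such that both [f0 (x_k) - f0 xbar] and the distance from [y_k] to
[F (x_k)] are at most [o(t_k ^ 2)] ([violating_pair]). By compactness [v_k] may
be assumed to converge to a unit vector [u] ([bounded_subsequence]). Dividing by
[t_k] shows that [u] is a critical direction ([critical_direction]), so the
hypothesis provides multipliers [alpha] and [lam_i] for [u].

The Lagrangian with these multipliers has zero gradient at [xbar]. Its increment
from [xbar] to [x_k] is therefore [t_k ^ 2 / 2] times its second derivative in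
the direction [u], up to [o(t_k ^ 2)] ([taylor2]). On the other hand, replacing
[F (x_k)] by [y_k] costs only [o(t_k ^ 2)], so that this increment is at most the
sum of the terms [<lam_i, y_(k,i) - F_i xbar>], up to [o(t_k ^ 2)]. Each of them
is nonpositive, because [lam_i] is a normal vector. When [F_i xbar] is a nonzero
boundary point [y] of the cone, more is true. The normal cone at [y] is the ray
spanned by [(- y_1, y_2, ..., y_s)] ([normal_cone_soc]), which is half the
gradient at [y] of the quadratic form [q = lorentz] that is nonpositive on the
cone. As [q y = 0] and [q z <= 0], the exact second-order expansion of [q] at [y]
gives, for every [z] in the cone,

  [<lam, z - y> <= - (|lam| / |y|) / 2 * q (z - y)],

which is [soc_curvature]. After division by [t_k ^ 2] and passage to the limit,
the second derivative of the Lagrangian plus the curvature terms of the cones is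
seen to be nonpositive ([second_order_le]), against the choice of the
multipliers. *)

(** * Euclidean inner product, quadratic forms and norms *)

Section InnerProduct.
Context {R : realType} {n : nat}.
Implicit Types (u v w : 'rV[R]_n) (a : R) (A : 'M[R]_n).

Lemma dotDl u v w : dot (u + v) w = dot u w + dot v w.
Proof. by rewrite -big_split; apply: eq_bigr => j _; rewrite mxE mulrDl. Qed.

Lemma dotZl a u w : dot (a *: u) w = a * dot u w.
Proof. by rewrite mulr_sumr; apply: eq_bigr => j _; rewrite mxE mulrA. Qed.

Lemma dotC u v : dot u v = dot v u.
Proof. by apply: eq_bigr => j _; rewrite mulrC. Qed.

Lemma dotZr a u w : dot w (a *: u) = a * dot w u.
Proof. by rewrite dotC dotZl dotC. Qed.

Lemma dot0l w : dot 0 w = 0.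
Proof. by apply: big1 => j _; rewrite mxE mul0r. Qed.

Lemma dotBl u v w : dot (u - v) w = dot u w - dot v w.
Proof. by rewrite -scaleN1r dotDl dotZl mulN1r. Qed.

Lemma dotBr u v w : dot w (u - v) = dot w u - dot w v.
Proof. by rewrite dotC dotBl !(dotC w). Qed.

Lemma dot_suml (I : Type) (r : seq I) (P : pred I) (f : I -> 'rV[R]_n) w :
  dot (\sum_(i <- r | P i) f i) w = \sum_(i <- r | P i) dot (f i) w.
Proof. by elim/big_rec2: _ => [|i y x _ <-]; rewrite ?dot0l ?dotDl. Qed.

Lemma quadE A u : quad A u = dot (u *m A) u.
Proof. by rewrite /quad mxE; apply: eq_bigr => j _; rewrite !mxE. Qed.

Lemma quadDl A B u : quad (A + B) u = quad A u + quad B u.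
Proof. by rewrite !quadE mulmxDr dotDl. Qed.

Lemma quadZl a A u : quad (a *: A) u = a * quad A u.
Proof. by rewrite !quadE -scalemxAr dotZl. Qed.

Lemma quad_suml (I : Type) (r : seq I) (P : pred I) (f : I -> 'M[R]_n) u :
  quad (\sum_(i <- r | P i) f i) u = \sum_(i <- r | P i) quad (f i) u.
Proof.
elim/big_rec2: _ => [|i y x _ <-]; last by rewrite quadDl.
by rewrite quadE mulmx0 dot0l.
Qed.

Lemma coord_le_norm u j : `|u 0 j| <= `|u|.
Proof.
by rewrite [leRHS]/Num.norm/= mx_normrE; exact: (le_bigmax _ _ (0, j)).
Qed.

Lemma norm_dot_le u v : `|dot u v| <= n%:R * `|u| * `|v|.
Proof.
rewrite (le_trans (ler_norm_sum _ _ _))//.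
rewrite -mulrA (_ : n%:R * _ = \sum_(j < n) (`|u| * `|v|)); last first.
  by rewrite sumr_const card_ord mulr_natl.
by apply: ler_sum => j _; rewrite normrM ler_pM ?coord_le_norm.
Qed.

Lemma enorm_ge0 u : 0 <= enorm u.
Proof. exact: sqrtr_ge0. Qed.

Lemma sqr_enorm u : enorm u ^+ 2 = dot u u.
Proof.
rewrite sqr_sqrtr; last by apply: sumr_ge0 => j _; exact: sqr_ge0.
by apply: eq_bigr => j _; rewrite expr2.
Qed.

Lemma enormZ a u : enorm (a *: u) = `|a| * enorm u.
Proof.
apply/eqP; rewrite -(@eqrXn2 _ 2) ?mulr_ge0 ?enorm_ge0//.
by rewrite exprMn !sqr_enorm dotZl dotZr real_normK ?num_real// mulrA expr2.
Qed.

Lemma coord_le_enorm u j : `|u 0 j| <= enorm u.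
Proof.
rewrite -sqrtr_sqr ler_wsqrtr// (bigD1 j)//= lerDl.
by apply: sumr_ge0 => k _; exact: sqr_ge0.
Qed.

Lemma norm_le_enorm u : `|u| <= enorm u.
Proof.
rewrite [leLHS]/Num.norm/= mx_normrE; apply: bigmax_le; first exact: enorm_ge0.
by move=> [i j] _ /=; rewrite ord1; exact: coord_le_enorm.
Qed.

Lemma enorm_eq0 u : enorm u = 0 -> u = 0.
Proof.
move=> u0; apply/rowP => j; rewrite mxE; apply/eqP.
by rewrite -normr_le0 -u0; exact: coord_le_enorm.
Qed.

End InnerProduct.

(** * Limits of row vectors *)

Section Limits.
Context {R : realType} {T : Type}.

Lemma cvg_row n (F : set_system T) {FF : Filter F} (v : T -> 'rV[R]_n)
    (u : 'rV[R]_n) :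
  (forall j, v k 0 j @[k --> F] --> u 0 j) -> v @ F --> u.
Proof.
move=> vu; apply/cvgrPdist_le => e e0.
have : \forall k \near F, forall j, `|u 0 j - v k 0 j| <= e.
  by apply: filter_forall => j; have /cvgrPdist_le := vu j; apply.
apply: filterS => k vk.
rewrite [leLHS]/Num.norm/= mx_normrE; apply: bigmax_le; first exact: ltW.
by move=> [i j] _ /=; rewrite ord1 !mxE.
Qed.

Lemma cvg_coord n (F : set_system T) {FF : Filter F} (v : T -> 'rV[R]_n)
    (u : 'rV[R]_n) j :
  v @ F --> u -> v k 0 j @[k --> F] --> u 0 j.
Proof.
move=> /cvgrPdist_le vu; apply/cvgrPdist_le => e /vu; apply: filterS => k.
by apply: le_trans; have := coord_le_norm (u - v k) j; rewrite !mxE.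
Qed.

Lemma cvg_sumr (I : finType) (P : pred I) (F : set_system T) {FF : Filter F}
    (f : I -> T -> R) (l : I -> R) :
  (forall i, P i -> f i k @[k --> F] --> l i) ->
  (\sum_(i | P i) f i k) @[k --> F] --> \sum_(i | P i) l i.
Proof. by move=> fl; apply: cvg_big => //; exact: add_continuous. Qed.

Lemma cvg_dot n (F : set_system T) {FF : Filter F} (v w : T -> 'rV[R]_n)
    (a b : 'rV[R]_n) :
  v @ F --> a -> w @ F --> b -> dot (v k) (w k) @[k --> F] --> dot a b.
Proof.
by move=> va wb; apply: cvg_sumr => j _; apply: cvgM; exact: cvg_coord.
Qed.

Lemma cvg_mulmx n p (F : set_system T) {FF : Filter F} (v : T -> 'rV[R]_n)
    (a : 'rV[R]_n) (A : 'M[R]_(n, p)) :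
  v @ F --> a -> (v k *m A) @[k --> F] --> a *m A.
Proof.
move=> va; apply: cvg_row => j; rewrite mxE; under eq_fun do rewrite mxE.
by apply: cvg_sumr => i _; apply: cvgMr_tmp; exact: cvg_coord.
Qed.

Lemma cvg_enorm n (F : set_system T) {FF : Filter F} (v : T -> 'rV[R]_n)
    (a : 'rV[R]_n) :
  v @ F --> a -> enorm (v k) @[k --> F] --> enorm a.
Proof.
move=> va; apply: (cvg_comp _ (@Num.sqrt R)); last exact: sqrt_continuous.
apply: cvg_sumr => j _; under eq_fun do rewrite expr2.
by rewrite expr2; apply: cvgM; exact: cvg_coord.
Qed.

End Limits.

(** * Taylor expansion of second order *)

Section Derivatives.
Context {R : realType} {n : nat}.

Lemma gradE (f : 'rV[R]_n -> R) x u :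
  differentiable f x -> 'D_u f x = dot (grad f x) u.
Proof.
move=> df; rewrite deriveE// [u in LHS]row_sum_delta linear_sum.
by apply: eq_bigr => j _; rewrite linearZ mxE deriveE// mulrC.
Qed.

(** The differential of a function without derivative is an arbitrary value, so
the entries of a Jacobian mean something only once the map is known to be
differentiable as a whole. *)
Lemma differentiable_row p (G : 'rV[R]_n -> 'rV[R]_p) x :
  (forall j, differentiable (fun y => G y 0 j) x) -> differentiable G x.
Proof.
move=> dG.
have -> : G = \sum_(j < p) (fun y => G y 0 j *: (delta_mx 0 j : 'rV[R]_p)).
  by apply/funext => y; rewrite [LHS]row_sum_delta fct_sumE.
by apply: differentiable_sum => j; apply: differentiableZl.
Qed.

Lemma mul_jacobianE p (G : 'rV[R]_n -> 'rV[R]_p) x u j :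
  (forall j, differentiable (fun y => G y 0 j) x) ->
  (u *m 'J G x) 0 j = dot (grad (fun y => G y 0 j) x) u.
Proof.
move=> dG; have dG' := differentiable_row dG.
rewrite -deriveEjacobian// derive_mx ?mxE ?gradE//.
exact: diff_derivable.
Qed.

(** The chain rule needed to apply the mean value theorem on a segment. *)
Lemma derive_along_line (f : 'rV[R]_n -> R) x h (s : R) :
  differentiable f (s *: h + x) ->
  is_derive s 1 (fun s : R => f (s *: h + x)) (dot (grad f (s *: h + x)) h).
Proof.
move=> df.
pose g (s : R) := s *: h + x.
have dg : is_diff s g ( *:%R ^~ h) by apply: is_diff_eq (addr0 _).
have dgs : differentiable g s by [].
have dfg : differentiable (f \o g) s by exact: differentiable_comp.
apply: DeriveDef; first exact: diff_derivable.
rewrite (_ : (fun s => _) = f \o g)// deriveE// diff_comp//.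
by rewrite /= diff_val scale1r -gradE// deriveE.
Qed.

(** The error of the expansion, restricted to the segment from [x] to [h + x],
has the derivative [<rem, h>], where [rem] is the error of the first-order
expansion of the gradient, hence small relative to [|h|]. The mean value theorem
then bounds the error itself. *)
Lemma taylor2 (f : 'rV[R]_n -> R) x (e : R) : C2 f -> 0 < e ->
  \forall h \near (0 : 'rV[R]_n),
  `|f (h + x) - f x - dot (grad f x) h - 2^-1 * quad (hess f x) h|
    <= e * `|h| ^+ 2.
Proof.
move=> [df /(_ x) /diff_locallyP [_ /eqaddoP dg] _] e0.
have n0 : (0 : R) < n%:R + 1 by rewrite ltr_wpDl.
have /nbhs_ballP [r /= r0 rP] := dg _ (divr_gt0 e0 n0).
apply/nbhs_ballP; exists r => //= h rh.
pose G := grad f x; pose H := hess f x.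
pose lf (s : R) := f (s *: h + x).
(* The Taylor polynomial without its constant term. *)
pose p : {poly R} := dot G h *: 'X + (2^-1 * quad H h) *: 'X^2.
pose phi : R -> R := lf - horner p.
pose rem (s : R) := grad f (s *: h + x) - G - (s *: h) *m H.
have dphi (s : R) : is_derive s 1 phi (dot (rem s) h).
  have dlf : is_derive s 1 lf (dot (grad f (s *: h + x)) h).
    exact/derive_along_line/df.
  apply: (is_derive_eq (is_deriveB dlf (is_derive_poly p s))).
  rewrite /rem !dotBl -scalemxAl dotZl -quadE /p !poly.derivE !hornerE.
  by field.
have [c] : exists2 c : R, c \in `]0, 1[ & phi 1 - phi 0 = dot (rem c) h * (1 - 0).
  apply: (@MVT R phi (fun s => dot (rem s) h) 0 1 ltr01 (fun t _ => dphi t)).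
  by apply: derivable_within_continuous => t _; case: (dphi t).
rewrite in_itv/= subr0 mulr1 => /andP[c0 c1] phic.
have -> : f (h + x) - f x - dot G h - 2^-1 * quad H h = dot (rem c) h.
  rewrite -phic /phi /lf !fctE scale1r scale0r add0r /p.
  by rewrite !(hornerD, hornerZ, hornerX, hornerXn); ring.
have ch : `|c *: h| <= `|h| by rewrite normrZ gtr0_norm// ler_piMl// ltW.
have rc : `|rem c| <= e / (n%:R + 1) * `|h|.
  have -> : rem c
      = (grad f \o shift x - (cst (grad f x) + 'd (grad f) x)) (c *: h).
    by rewrite /rem /G /H !fctE /= opprD addrA /hess /jacobian mul_rV_lin1.
  apply: le_trans (ler_wpM2l _ ch); last by rewrite divr_ge0// ltW.
  apply: rP; move: rh; rewrite -!ball_normE /ball_/= !sub0r !normrN.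
  exact: le_lt_trans.
rewrite (le_trans (norm_dot_le _ _))// expr2 mulrA ler_wpM2r//.
rewrite (le_trans (ler_wpM2l _ rc))// mulrA ler_wpM2r// mulrCA.
by rewrite ler_piMr ?(ltW e0)// ler_pdivrMr// mul1r lerDl.
Qed.

(** The directions may vary: on a bounded set of directions the error in [taylor2]
is uniformly [o(t ^ 2)], and the quadratic form is continuous. *)
Lemma taylor2_seq (f : 'rV[R]_n -> R) (x : 'rV[R]_n) (t : nat -> R)
    (v : nat -> 'rV[R]_n) (u : 'rV[R]_n) :
  C2 f -> (forall k, 0 < t k) -> t @ \oo --> (0 : R) -> v @ \oo --> u ->
  (f (x + t k *: v k) - f x - t k * dot (grad f x) (v k)) / t k ^+ 2 @[k --> \oo]
    --> 2^-1 * quad (hess f x) u.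
Proof.
move=> fC2 t0 tc vu.
pose q k := 2^-1 * quad (hess f x) (v k).
have qc : q k @[k --> \oo] --> 2^-1 * quad (hess f x) u.
  apply: cvgMl_tmp; under eq_fun do rewrite quadE; rewrite quadE.
  by apply: cvg_dot => //; exact: cvg_mulmx.
have vn : `|v k| @[k --> \oo] --> `|u| by exact: cvg_norm.
have tv0 : t k *: v k @[k --> \oo] --> (0 : 'rV[R]_n).
  by rewrite -(scale0r u); exact: cvgZ.
rewrite -[X in _ --> X]addr0.
under eq_fun => k do rewrite -(subrK (q k) (_ / _)) addrC.
apply: cvgD => //; apply/cvgr0Pnorm_le => e e0.
have M0 : 0 < (`|u| + 1) ^+ 2 by rewrite exprn_gt0// ltr_wpDl.
have := tv0 _ (taylor2 x fC2 (divr_gt0 e0 M0)).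
have : \forall k \near \oo, `|v k| <= `|u| + 1.
  have /cvgrPdist_le/(_ 1 ltr01) := vn; apply: filterS => k.
  by rewrite ler_distlC => /andP[].
apply: filterS2 => k vk; rewrite /= (addrC (t k *: v k)) => tk.
have tk2 : 0 < t k ^+ 2 by rewrite exprn_gt0.
have -> : (f (x + t k *: v k) - f x - t k * dot (grad f x) (v k)) / t k ^+ 2 - q k
  = (f (x + t k *: v k) - f x - dot (grad f x) (t k *: v k)
     - 2^-1 * quad (hess f x) (t k *: v k)) / t k ^+ 2.
  rewrite /q dotZr !quadE -scalemxAl dotZl dotZr.
  by field; rewrite gt_eqF.
rewrite normrM normfV (gtr0_norm tk2) ler_pdivrMr// (le_trans tk)//.
rewrite normrZ (gtr0_norm (t0 k)) exprMn mulrCA mulrC ler_wpM2r ?(ltW tk2)//.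
by rewrite mulrAC ler_pdivrMr// ler_wpM2l ?(ltW e0)// lerXn2r// nnegrE ?addr_ge0.
Qed.

Lemma taylor1_seq (f : 'rV[R]_n -> R) (x : 'rV[R]_n) (t : nat -> R)
    (v : nat -> 'rV[R]_n) (u : 'rV[R]_n) :
  C2 f -> (forall k, 0 < t k) -> t @ \oo --> (0 : R) -> v @ \oo --> u ->
  (f (x + t k *: v k) - f x) / t k @[k --> \oo] --> dot (grad f x) u.
Proof.
move=> fC2 t0 tc vu.
have g : dot (grad f x) (v k) @[k --> \oo] --> dot (grad f x) u.
  by apply: cvg_dot => //; exact: cvg_cst.
have h := taylor2_seq (x := x) fC2 t0 tc vu.
rewrite -[dot _ _]addr0 -(mul0r (2^-1 * quad (hess f x) u)).
rewrite (_ : (fun k => _) = (fun k => dot (grad f x) (v k)) + (t \*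
  (fun k => (f (x + t k *: v k) - f x - t k * dot (grad f x) (v k)) / t k ^+ 2))).
  exact: cvgD g (cvgM tc h).
apply/funext => k; rewrite fctE /=.
by field; rewrite gt_eqF.
Qed.

End Derivatives.

(** * Normal vectors and curvature of the second-order cone *)

Section SecondOrderCone.
Context {R : realType} {s : nat}.
Implicit Types (u v w y z lam : 'rV[R]_s) (a : R).

(** The inner product of the parts of [u] and [v] other than the first
coordinate. *)
Definition tdot u v : R := \sum_(j < s | (0 < j)%N) u 0 j * v 0 j.

(** The quadratic form whose nonpositivity, together with a nonnegative first
coordinate, describes the second-order cone. It carries the curvature of the
boundary of the cone. *)
Definition lorentz y : R := tail_norm y ^+ 2 - coord1 y ^+ 2.

Lemma tdotC u v : tdot u v = tdot v u.
Proof. by apply: eq_bigr => j _; rewrite mulrC. Qed.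

Lemma tdotBl u v w : tdot (u - v) w = tdot u w - tdot v w.
Proof.
by rewrite /tdot -sumrB; apply: eq_bigr => j _; rewrite !mxE mulrBl.
Qed.

Lemma tdotBr u v w : tdot w (u - v) = tdot w u - tdot w v.
Proof. by rewrite tdotC tdotBl !(tdotC w). Qed.

Lemma tdotZl a u v : tdot (a *: u) v = a * tdot u v.
Proof. by rewrite mulr_sumr; apply: eq_bigr => j _; rewrite mxE mulrA. Qed.

Lemma tdotZr a u v : tdot u (a *: v) = a * tdot u v.
Proof. by rewrite tdotC tdotZl tdotC. Qed.

Lemma sqr_tail_norm y : tail_norm y ^+ 2 = tdot y y.
Proof.
rewrite sqr_sqrtr; last by apply: sumr_ge0 => j _; exact: sqr_ge0.
by apply: eq_bigr => j _; rewrite expr2.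
Qed.

Lemma tail_norm_ge0 y : 0 <= tail_norm y.
Proof. exact: sqrtr_ge0. Qed.

Lemma tail_normE y : tail_norm y = Num.sqrt (tdot y y).
Proof. by rewrite -sqr_tail_norm sqrtr_sqr ger0_norm// tail_norm_ge0. Qed.

Lemma coord1B u v : coord1 (u - v) = coord1 u - coord1 v.
Proof.
case: s u v => [|s'] u v; last by rewrite !coord1E !mxE.
rewrite /coord1 /image_mem (_ : enum 'I_0 = [::]) ?subr0//.
by apply: size0nil; rewrite size_enum_ord.
Qed.

Lemma coord1Z a u : coord1 (a *: u) = a * coord1 u.
Proof.
case: s u => [|s'] u; last by rewrite !coord1E !mxE.
rewrite /coord1 /image_mem (_ : enum 'I_0 = [::]) ?mulr0//.
by apply: size0nil; rewrite size_enum_ord.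
Qed.

Lemma lorentzZ a y : lorentz (a *: y) = a ^+ 2 * lorentz y.
Proof. by rewrite /lorentz !sqr_tail_norm tdotZl tdotZr coord1Z; ring. Qed.

Lemma cvg_coord1 (T : Type) (F : set_system T) {FF : Filter F} (v : T -> 'rV[R]_s)
    (y : 'rV[R]_s) : v @ F --> y -> coord1 (v k) @[k --> F] --> coord1 y.
Proof.
case: s v y => [|s'] v y vy.
  rewrite (_ : (fun k => _) = fun=> coord1 y); first exact: cvg_cst.
  by apply/funext => k; congr coord1; apply/rowP => -[].
rewrite coord1E; under eq_fun do rewrite coord1E; exact: cvg_coord.
Qed.

Lemma cvg_tdot (T : Type) (F : set_system T) {FF : Filter F} (v : T -> 'rV[R]_s)
    (y : 'rV[R]_s) : v @ F --> y -> tdot (v k) (v k) @[k --> F] --> tdot y y.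
Proof. by move=> vy; apply: cvg_sumr => j _; apply: cvgM; exact: cvg_coord. Qed.

Lemma cvg_lorentz (T : Type) (F : set_system T) {FF : Filter F} (v : T -> 'rV[R]_s)
    (y : 'rV[R]_s) : v @ F --> y -> lorentz (v k) @[k --> F] --> lorentz y.
Proof.
move=> vy; rewrite /lorentz sqr_tail_norm.
under eq_fun do rewrite sqr_tail_norm expr2; rewrite expr2.
by apply: cvgB; [exact: cvg_tdot | apply: cvgM; exact: cvg_coord1].
Qed.

Lemma cvg_tail_norm (T : Type) (F : set_system T) {FF : Filter F}
    (v : T -> 'rV[R]_s) (y : 'rV[R]_s) :
  v @ F --> y -> tail_norm (v k) @[k --> F] --> tail_norm y.
Proof.
move=> vy; rewrite tail_normE; under eq_fun do rewrite tail_normE.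
apply: (cvg_comp _ (@Num.sqrt R)); last exact: sqrt_continuous.
exact: cvg_tdot.
Qed.

Lemma soc_tdot y : soc s y -> tdot y y <= coord1 y ^+ 2.
Proof.
move=> yQ; rewrite -sqr_tail_norm lerXn2r// ?nnegrE ?tail_norm_ge0//.
exact: le_trans (tail_norm_ge0 y) yQ.
Qed.

Lemma socZ a y : 0 <= a -> soc s y -> soc s (a *: y).
Proof.
move=> a0 yQ; rewrite /soc /= tail_normE tdotZl tdotZr coord1Z mulrA -expr2.
by rewrite sqrtrM ?sqr_ge0// sqrtr_sqr ger0_norm// -tail_normE ler_wpM2l.
Qed.

(** [tail_norm] and [coord1] are continuous, so strict inequality between them
persists near [y]. *)
Lemma soc_boundaryE y : soc s y -> ~ interior (soc s) y -> tail_norm y = coord1 y.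
Proof.
move=> yQ yI; apply/eqP; rewrite eq_le; apply/andP; split=> //.
rewrite leNgt; apply/negP => ylt; apply: yI.
have c : (coord1 z - tail_norm z) @[z --> y] --> coord1 y - tail_norm y.
  have c1 := @cvg_coord1 _ (nbhs y) (nbhs_filter y) id y cvg_id.
  have c2 := @cvg_tail_norm _ (nbhs y) (nbhs_filter y) id y cvg_id.
  exact: (@cvgB _ _ _ (nbhs y) (nbhs_filter y) _ _ _ _ c1 c2).
have := cvgr_gt _ c 0; rewrite subr_gt0 => /(_ _ ylt).
by apply: filterS => z; rewrite subr_gt0 => /ltW.
Qed.

(** Both [2 y] and [0] are in the cone, and the two inequalities that they give
are opposite. *)
Lemma normal_cone_dot0 y lam : soc s y -> normal_cone (soc s) y lam ->
  dot lam y = 0.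
Proof.
move=> yQ lamN; apply/eqP; rewrite eq_le; apply/andP; split.
  have := lamN _ (socZ (ler0n _ 2) yQ).
  by rewrite scaler_nat mulr2n addrK.
have := lamN _ (socZ (lexx 0) yQ).
by rewrite scale0r sub0r -scaleN1r dotZr mulN1r oppr_le0.
Qed.

Hypothesis s_gt0 : (0 < s)%N.

Lemma dot_tdot u v : dot u v = coord1 u * coord1 v + tdot u v.
Proof.
move: u v; rewrite /tdot /dot; case: s s_gt0 => // s' _ u v.
rewrite !coord1E (bigD1 ord0)//=; congr (_ + _).
by apply: eq_bigl => j; rewrite lt0n.
Qed.

Let test_vector a y : 'rV[R]_s := \row_j (if (0 < j)%N then y 0 j else a).

Let coord1_test a y : coord1 (test_vector a y) = a.
Proof.
by move: y; rewrite /test_vector; case: s s_gt0 => // s' _ y; rewrite coord1E mxE.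
Qed.

Let tdot_test a y w : tdot w (test_vector a y) = tdot w y.
Proof. by apply: eq_bigr => j j0; rewrite mxE j0. Qed.

(** The second-order cone is self-dual. Only two points of the cone are needed to
see that the negative of [lam] is in it: the first unit vector, and the tail of
[lam] completed by its own norm in the first coordinate. *)
Lemma polar_soc lam : (forall z, soc s z -> dot lam z <= 0) ->
  coord1 lam <= 0 /\ tdot lam lam <= coord1 lam ^+ 2.
Proof.
move=> lamQ.
have lam1 : coord1 lam <= 0.
  have := lamQ (test_vector 1 0); rewrite dot_tdot coord1_test mulr1 tdot_test.
  rewrite (_ : tdot lam 0 = 0) ?addr0; last first.
    by apply: big1 => j _; rewrite mxE mulr0.
  apply; rewrite /soc /= tail_normE coord1_test tdot_test tdotC tdot_test.
  by rewrite (_ : tdot 0 0 = 0) ?sqrtr0//; apply: big1 => j _; rewrite mxE mulr0.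
split=> //.
have /lamQ : soc s (test_vector (tail_norm lam) lam).
  by rewrite /soc /= coord1_test tail_normE tdot_test tdotC tdot_test -tail_normE.
rewrite dot_tdot coord1_test tdot_test -sqr_tail_norm.
have := tail_norm_ge0 lam.
nra.
Qed.

(** This is the equality case of the Cauchy-Schwarz inequality. With [c] chosen so
that the first coordinates fit, [<lam, y> = 0] gives the inner product of the
tails of [lam] and [y], and expanding the square of the distance between the
tails of [lam] and [c y] leaves [|tail lam| ^ 2 - lam_1 ^ 2], which is nonpositive
by [polar_soc]. *)
Lemma normal_cone_soc y lam :
  tail_norm y = coord1 y -> 0 < coord1 y -> normal_cone (soc s) y lam ->
  exists c : R, [/\ 0 <= c, coord1 lam = - c * coord1 y
                  & forall w, tdot lam w = c * tdot y w].
Proof.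
move=> ty y1 lamN.
have yQ : soc s y by rewrite /soc /= ty.
have lamy := normal_cone_dot0 yQ lamN.
(* As [lam] annihilates [y], being normal at [y] and at [0] amount to the same. *)
have [|lam1 lam2] := @polar_soc lam.
  by move=> z zQ; have := lamN z zQ; rewrite dotBr lamy subr0.
pose c := - (coord1 lam / coord1 y); exists c.
have cy : coord1 lam = - c * coord1 y by rewrite /c opprK divfK// gt_eqF.
split=> //; first by rewrite oppr_ge0 mulr_le0_ge0// invr_ge0 ltW.
have tyy : tdot y y = coord1 y ^+ 2 by rewrite -sqr_tail_norm ty.
have tly : tdot lam y = c * coord1 y ^+ 2.
  by move: lamy; rewrite dot_tdot cy => /eqP; rewrite addr_eq0 => /eqP; lra.
have : \sum_(j < s | (0 < j)%N) (lam 0 j - c * y 0 j) ^+ 2 = 0.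
  apply/eqP; rewrite eq_le; apply/andP; split; last first.
    by apply: sumr_ge0 => j _; exact: sqr_ge0.
  have -> : \sum_(j < s | (0 < j)%N) (lam 0 j - c * y 0 j) ^+ 2
      = tdot (lam - c *: y) (lam - c *: y).
    by apply: eq_bigr => j _; rewrite !mxE expr2.
  rewrite tdotBl !tdotBr !tdotZl !tdotZr (tdotC y lam) tly tyy.
  by move: lam2; rewrite cy; lra.
move=> /psumr_eq0P lamcy w; rewrite mulr_sumr; apply: eq_bigr => j j0.
have /eqP := lamcy (fun j _ => sqr_ge0 _) j j0.
by rewrite sqrf_eq0 subr_eq0 => /eqP ->; rewrite mulrA.
Qed.

(** With [lam] equal to [c] times the reflection of [y], the left-hand side is
exactly [c / 2 * (lorentz z - lorentz (z - y))], since [lorentz y = 0]; and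
[lorentz z <= 0]. Here [c] is the ratio of the norms, because reflecting the first
coordinate is an isometry. *)
Lemma soc_curvature y lam z :
  soc s y -> (bdry (soc s) `\ 0) y -> normal_cone (soc s) y lam -> soc s z ->
  dot lam (z - y) <= - (2^-1 * (enorm lam / enorm y * lorentz (z - y))).
Proof.
move=> yQ [[_ yI] y0] lamN zQ.
have ty := soc_boundaryE yQ yI.
have tyy : tdot y y = coord1 y ^+ 2 by rewrite -sqr_tail_norm ty.
have ey0 : enorm y != 0 by apply/eqP => /enorm_eq0.
have y1 : 0 < coord1 y.
  rewrite lt_neqAle -{2}ty tail_norm_ge0 andbT eq_sym.
  apply: contra_neq ey0 => y1; apply/eqP; rewrite -sqrf_eq0 sqr_enorm dot_tdot.
  by rewrite tyy y1 mulr0 expr0n addr0.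
have [c [c0 lam1 lamt]] := normal_cone_soc ty y1 lamN.
have -> : enorm lam / enorm y = c.
  apply: (mulIf ey0); rewrite divfK//; apply/eqP.
  rewrite -(@eqrXn2 _ 2) ?mulr_ge0 ?enorm_ge0// exprMn !sqr_enorm !dot_tdot.
  by rewrite lamt tdotC lamt lam1; apply/eqP; ring.
have zz := soc_tdot zQ.
rewrite dot_tdot lamt lam1 /lorentz sqr_tail_norm tdotBl !tdotBr coord1B.
by rewrite (tdotC z y) tyy; nra.
Qed.

End SecondOrderCone.

(** * Expansions of vector-valued maps and compactness *)

Section MoreLimits.
Context {R : realType} {n : nat}.

Lemma eq_cvg_to (f g : nat -> R) (a : R) :
  g @ \oo --> a -> f =1 g -> f @ \oo --> a.
Proof. by move=> + /funext ->. Qed.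

Lemma taylor2_row p (G : 'rV[R]_n -> 'rV[R]_p) (x : 'rV[R]_n) (t : nat -> R)
    (v : nat -> 'rV[R]_n) (u : 'rV[R]_n) :
  (forall j, C2 (fun y => G y 0 j)) -> (forall k, 0 < t k) ->
  t @ \oo --> (0 : R) -> v @ \oo --> u ->
  (t k ^- 2 *: (G (x + t k *: v k) - G x - t k *: (v k *m 'J G x))) @[k --> \oo]
    --> \row_j (2^-1 * quad (hess (fun y => G y 0 j) x) u).
Proof.
move=> GC2 t0 tc vu; apply: cvg_row => j; rewrite mxE.
apply: (eq_cvg_to (taylor2_seq (x := x) (GC2 j) t0 tc vu)) => k.
rewrite -mul_jacobianE; last by move=> i; case: (GC2 i).
by rewrite [RHS]mulrC !mxE.
Qed.

(** An error of order [o(t ^ 2)] in the values of [G] does not change the limit of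
the difference quotient. When the points [y k] lie in a set, the limit is
therefore a tangent direction of that set. *)
Lemma taylor1_row p (G : 'rV[R]_n -> 'rV[R]_p) (x : 'rV[R]_n) (t : nat -> R)
    (v : nat -> 'rV[R]_n) (u : 'rV[R]_n) (y : nat -> 'rV[R]_p) :
  (forall j, C2 (fun y => G y 0 j)) -> (forall k, 0 < t k) ->
  t @ \oo --> (0 : R) -> v @ \oo --> u ->
  (t k ^- 2 *: (y k - G (x + t k *: v k))) @[k --> \oo] --> (0 : 'rV[R]_p) ->
  ((t k)^-1 *: (y k - G x)) @[k --> \oo] --> u *m 'J G x.
Proof.
move=> GC2 t0 tc vu yc; apply: cvg_row => j.
have yj := cvg_coord (FF := eventually_filter) (j := j) yc.
rewrite mul_jacobianE; last by move=> i; case: (GC2 i).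
have h := cvgD (taylor1_seq (x := x) (GC2 j) t0 tc vu) (cvgM tc yj).
rewrite mul0r addr0 in h.
apply: (eq_cvg_to (h _ _)) => k; rewrite fctE /= !mxE.
by field; rewrite gt_eqF.
Qed.

(** The indices [f k] need not increase: the estimates for the index [j] improve
with [j], so [k <= f k] is enough to pass to the selected terms. *)
Lemma bounded_subsequence (v : nat -> 'rV[R]_n) : (forall k, `|v k| <= 1) ->
  exists (f : nat -> nat) (u : 'rV[R]_n),
    (forall k, (k <= f k)%N) /\ v (f k) @[k --> \oo] --> u.
Proof.
move=> v1.
pose A := [set w : 'rV[R]_n | `|w| <= 1].
have Acompact : compact A.
  apply: bounded_closed_compact.
    by exists 1; split=> // M M1 w /= w1; rewrite (le_trans w1)// ltW.
  apply: (@closed_comp _ _ (fun w : 'rV[R]_n => `|w|) [set r | r <= 1]).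
    by move=> w _; exact: norm_continuous.
  exact: closed_le.
have [|u [_ uv]] := Acompact (v @ \oo) _.
  by exists 0%N => // k _; exact: v1.
have sel k : exists j, (k <= j)%N /\ `|u - v j| < harmonic k.
  have : (v @ \oo) [set v j | j in [set j | (k <= j)%N]].
    by exists k => // j kj; exists j.
  move=> /uv /(_ (nbhsx_ballx u _ (harmonic_gt0 k)))[_ [[j kj <-]]].
  by rewrite -ball_normE /=; exists j.
have [f fP] := choice sel.
exists f, u; split=> [k|]; first by case: (fP k).
apply/cvgrPdist_lt => e e0.
have /cvgrPdist_lt/(_ e e0) := @cvg_harmonic R.
apply: filterS => k; rewrite sub0r normrN ger0_norm ?harmonic_ge0//.
by apply: lt_trans; case: (fP k).
Qed.

Lemma dot_mul_tr p (lam : 'rV[R]_p) (A : 'M[R]_(n, p)) (v : 'rV[R]_n) :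
  dot (lam *m A^T) v = dot lam (v *m A).
Proof.
have dotE q (a b : 'rV[R]_q) : dot a b = (a *m b^T) 0 0.
  by rewrite mxE; apply: eq_bigr => j _; rewrite mxE.
by rewrite !dotE trmx_mul mulmxA.
Qed.

End MoreLimits.

(** * The stacked constraint map *)

Section Stack.
Context {R : realType} {n l : nat} {m : 'I_l -> nat}.
Variable F : forall i, 'rV[R]_n -> 'rV[R]_(m i).

Lemma stack_coordE (x : 'rV[R]_n) s :
  stack F x 0 s = F (tagnat.sig1 s) x 0 (tagnat.sig2 s).
Proof. by rewrite mxE. Qed.

Lemma C2_stack (s : 'I_(\sum_i m i)) : (forall i j, C2 (fun x => F i x 0 j)) ->
  C2 (fun x => stack F x 0 s).
Proof.
move=> FC2.
rewrite (_ : (fun x => _) = fun x => F (tagnat.sig1 s) x 0 (tagnat.sig2 s))//.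
by apply/funext => x; rewrite stack_coordE.
Qed.

Lemma submxrow_stack (x : 'rV[R]_n) i : submxrow (stack F x) i = F i x.
Proof. exact: mxrowK. Qed.

End Stack.

(** * The limiting second-order inequality *)

Section SecondOrderInequality.
Context {R : realType} {n l : nat} {m : 'I_l -> nat}.
Context {f0 : 'rV[R]_n -> R} {F : forall i, 'rV[R]_n -> 'rV[R]_(m i)}.
Hypothesis f0_C2 : C2 f0.
Hypothesis F_C2 : forall i j, C2 (fun x => F i x 0 j).
Context {xbar : 'rV[R]_n} {t : nat -> R} {v : nat -> 'rV[R]_n} {u : 'rV[R]_n}.
Context {y : nat -> 'rV[R]_(\sum_i m i)} {eta : nat -> R}.
Hypothesis t_gt0 : forall k, 0 < t k.
Hypothesis t_cvg0 : t @ \oo --> (0 : R).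
Hypothesis v_cvg : v @ \oo --> u.
Hypothesis eta_cvg0 : eta @ \oo --> (0 : R).
Hypothesis y_feasible : forall k, soc_prod m (y k).
Hypothesis f0_le : forall k, f0 (xbar + t k *: v k) - f0 xbar <= eta k * t k ^+ 2.
Hypothesis y_near : forall k,
  enorm (y k - stack F (xbar + t k *: v k)) <= eta k * t k ^+ 2.

Let t_neq0 k : t k != 0. Proof. by rewrite gt_eqF. Qed.

Lemma feasible_error_cvg0 :
  (t k ^- 2 *: (y k - stack F (xbar + t k *: v k))) @[k --> \oo]
    --> (0 : 'rV[R]_(\sum_i m i)).
Proof.
apply/cvgr0Pnorm_le => e e0.
have /cvgr0Pnorm_le/(_ e e0) := eta_cvg0; apply: filterS => k etak.
rewrite (le_trans (norm_le_enorm _))// enormZ normfV normrX gtr0_norm//.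
rewrite mulrC ler_pdivrMr ?exprn_gt0// (le_trans (y_near k))//.
by rewrite ler_pM2r ?exprn_gt0// (le_trans (ler_norm _)).
Qed.

(** The feasible points [y k] realize the tangent direction, and the increment of
[f0] is at most of order [o(t)]. *)
Lemma critical_direction : critical_cone f0 (stack F) (soc_prod m) xbar u.
Proof.
split.
  exists t, (fun k => (t k)^-1 *: (y k - stack F xbar)); split.
  - exact: t_gt0.
  - exact: t_cvg0.
  - exact: (taylor1_row (G := stack F) (fun s => C2_stack s F_C2) t_gt0 t_cvg0
      v_cvg feasible_error_cvg0).
  - by move=> k; rewrite scalerA mulfV// scale1r addrC subrK.
have := taylor1_seq (x := xbar) f0_C2 t_gt0 t_cvg0 v_cvg.
move=> /ler_cvg_to/(_ (cvgM eta_cvg0 t_cvg0)); rewrite mul0r; apply.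
apply: nearW => k /=; rewrite ler_pdivrMr// -mulrA -expr2.
exact: f0_le.
Qed.

(** [S k] is the increment of the Lagrangian from [xbar] to [x k] divided by
[t k ^ 2], because the first-order terms subtracted in [T0] and [T] cancel by
stationarity. [U k] is the upper bound for it that comes from the objective, the
feasibility error [r] and the curvature of the cones. The inequality is that
between their limits. *)
Lemma second_order_le (alpha : R) (lam : forall i, 'rV[R]_(m i)) :
  (forall i, (0 < m i)%N) -> soc_prod m (stack F xbar) -> 0 <= alpha ->
  (forall i, normal_cone (soc (m i)) (F i xbar) (lam i)) ->
  0 = alpha *: grad f0 xbar + \sum_(i < l) lam i *m ('J (F i) xbar)^T ->
  quad (alpha *: hess f0 xbar
        + \sum_(i < l) \sum_(j < m i)
            lam i 0 j *: hess (fun x => F i x 0 j) xbar) u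
  + \sum_(i < l | F i xbar \in bdry (soc (m i)) `\ 0)
      enorm (lam i) / enorm (F i xbar) * lorentz (u *m 'J (F i) xbar) <= 0.
Proof.
move=> m_gt0 xbarC alpha0 lamN stat.
pose x k := xbar + t k *: v k.
pose I := [pred i | F i xbar \in bdry (soc (m i)) `\ 0].
pose c i := enorm (lam i) / enorm (F i xbar).
pose yy i k : 'rV[R]_(m i) := submxrow (y k) i.
pose w i k := (t k)^-1 *: (yy i k - F i xbar).
pose r i k := t k ^- 2 *: (yy i k - F i (x k)).
pose T0 k := (f0 (x k) - f0 xbar - t k * dot (grad f0 xbar) (v k)) / t k ^+ 2.
pose T i k := t k ^- 2 *: (F i (x k) - F i xbar - t k *: (v k *m 'J (F i) xbar)).
pose Q i := \row_j (2^-1 * quad (hess (fun z => F i z 0 j) xbar) u).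
have T0c : T0 @ \oo --> 2^-1 * quad (hess f0 xbar) u by exact: taylor2_seq.
have Tc i : T i @ \oo --> Q i.
  exact: (taylor2_row (G := F i) (@F_C2 i) t_gt0 t_cvg0 v_cvg).
have rc i : r i @ \oo --> (0 : 'rV[R]_(m i)).
  apply: cvg_row => j.
  have h := cvg_coord (FF := eventually_filter) (j := tagnat.Rank i j)
    feasible_error_cvg0.
  rewrite mxE in h; rewrite mxE; apply: (eq_cvg_to h) => k.
  rewrite /r /yy -submxrow_stack -submxrowB [LHS]mxE [RHS]mxE.
  by congr (_ * _); rewrite [LHS]mxE.
have wc i : w i @ \oo --> u *m 'J (F i) xbar.
  exact: (taylor1_row (G := F i) (@F_C2 i) t_gt0 t_cvg0 v_cvg (rc i)).
have F_feasible i : soc (m i) (F i xbar).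
  by have := xbarC i; rewrite submxrow_stack.
pose S k := alpha * T0 k + \sum_i dot (lam i) (T i k).
pose U k := alpha * eta k - \sum_i dot (lam i) (r i k)
            - \sum_(i | I i) 2^-1 * (c i * lorentz (w i k)).
have Sc : S @ \oo --> alpha * (2^-1 * quad (hess f0 xbar) u)
                     + \sum_i dot (lam i) (Q i).
  apply: cvgD; first exact: cvgMl_tmp.
  apply: cvg_sumr => i _.
  exact: (cvg_dot (v := fun=> lam i) (w := T i) (cvg_cst _) (Tc i)).
have Uc : U @ \oo --> alpha * 0 - \sum_i dot (lam i) 0
                     - \sum_(i | I i) 2^-1 * (c i * lorentz (u *m 'J (F i) xbar)).
  apply: cvgB; [apply: cvgB|].
  - exact: cvgMl_tmp.
  - apply: cvg_sumr => i _.
    exact: (cvg_dot (v := fun=> lam i) (w := r i) (cvg_cst _) (rc i)).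
  - apply: cvg_sumr => i _; do 2 apply: cvgMl_tmp.
    exact: (cvg_lorentz (v := w i) (wc i)).
have SU k : S k <= U k.
  have tk2 : 0 < t k ^+ 2 by rewrite exprn_gt0.
  have stat_k : alpha * dot (grad f0 xbar) (v k)
      = - \sum_i dot (lam i) (v k *m 'J (F i) xbar).
    apply/eqP; rewrite -addr_eq0; apply/eqP.
    have /(congr1 (fun z => dot z (v k))) := stat.
    rewrite dot0l dotDl dotZl dot_suml => h; rewrite [RHS]h; congr (_ + _).
    by apply: eq_bigr => i _; rewrite dot_mul_tr.
  have f0_part : alpha * T0 k
      <= alpha * eta k - (t k)^-1 * (alpha * dot (grad f0 xbar) (v k)).
    have -> : alpha * T0 k = alpha * ((f0 (x k) - f0 xbar) / t k ^+ 2)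
        - (t k)^-1 * (alpha * dot (grad f0 xbar) (v k)).
      by rewrite /T0; field.
    by rewrite lerD2r ler_wpM2l// ler_pdivrMr// f0_le.
  (* The feasible point is inserted between the two values of [F i]. *)
  have F_part i : dot (lam i) (T i k) = t k ^- 2 * dot (lam i) (yy i k - F i xbar)
      - dot (lam i) (r i k) - (t k)^-1 * dot (lam i) (v k *m 'J (F i) xbar).
    by rewrite /T /r !(dotZr, dotBr); field.
  have cone_part : \sum_i t k ^- 2 * dot (lam i) (yy i k - F i xbar)
      <= - \sum_(i | I i) 2^-1 * (c i * lorentz (w i k)).
    rewrite -sumrN [leRHS]big_mkcond; apply: ler_sum => i _.
    case: ifPn => [/set_mem iI|_]; last first.
      by rewrite mulr_ge0_le0 ?invr_ge0 ?(ltW tk2)//; exact/lamN/y_feasible.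
    rewrite /w lorentzZ exprVn.
    have tki : 0 <= t k ^- 2 by rewrite invr_ge0 ltW.
    have h := soc_curvature (m_gt0 i) (@F_feasible i) iI (@lamN i)
      (@y_feasible k i).
    apply: le_trans (ler_wpM2l tki h) _.
    by rewrite le_eqVlt -/(c i) -/(yy i k); apply/orP; left; apply/eqP; ring.
  rewrite /S /U (eq_bigr _ (fun i _ => F_part i)) !sumrB.
  rewrite -[X in _ + (_ - X) <= _]mulr_sumr.
  by rewrite stat_k in f0_part; lra.
pose proof (ler_cvg_to Sc Uc (nearW _ SU)) as lim_le; move: lim_le.
have -> : \sum_i dot (lam i) (0 : 'rV[R]_(m i)) = 0.
  by apply: big1 => i _; rewrite dotC dot0l.
rewrite -mulr_sumr quadDl quadZl quad_suml.
have -> : \sum_i dot (lam i) (Q i) = 2^-1 * \sum_(i < l)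
    quad (\sum_(j < m i) lam i 0 j *: hess (fun z => F i z 0 j) xbar) u.
  rewrite mulr_sumr; apply: eq_bigr => i _.
  rewrite quad_suml mulr_sumr; apply: eq_bigr => j _.
  by rewrite quadZl !mxE mulrCA.
lra.
Qed.

End SecondOrderInequality.

(** * Sequences that violate quadratic growth *)

(** The failure of the growth inequality at a point [x] bounds the infimum that
defines the distance strictly, so some element of [C] satisfies the same bound.
The point is not [xbar], where the increment of [f0] and its strict upper bound
would both be zero. *)
Lemma violating_pair (R : realType) n N (f0 : 'rV[R]_n -> R)
    (G : 'rV[R]_n -> 'rV[R]_N) (C : set 'rV[R]_N) (xbar : 'rV[R]_n) (e : R) :
  C (G xbar) -> ~ essential_local_min2 f0 G C xbar -> 0 < e ->
  exists xy : 'rV[R]_n * 'rV[R]_N,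
    [/\ 0 < enorm (xy.1 - xbar) <= e,
        f0 xy.1 - f0 xbar <= e * enorm (xy.1 - xbar) ^+ 2,
        C xy.2 & enorm (xy.2 - G xy.1) <= e * enorm (xy.1 - xbar) ^+ 2].
Proof.
move=> CG nmin e0.
have [x [xe]] : exists x, enorm (x - xbar) <= e /\
    Num.max (f0 x - f0 xbar) (dist_set (G x) C) < e * enorm (x - xbar) ^+ 2.
  apply: contrapT => nx; apply: nmin; split=> //; exists e, e; split=> // x xe.
  by rewrite leNgt; apply/negP => h; apply: nx; exists x.
rewrite gt_max => /andP[f0x distx].
have [|_ [y Cy <-] ylt] := inf_lt _ distx.
  by exists (enorm (G x - G xbar)), (G xbar).
exists (x, y); split=> //=; last 2 first.
- exact: ltW.
- by rewrite -[y - _]opprB -scaleN1r enormZ normrN1 mul1r ltW.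
rewrite xe andbT lt_neqAle enorm_ge0 andbT eq_sym.
apply/eqP => /enorm_eq0 /eqP; rewrite subr_eq0 => /eqP xx.
move: f0x; rewrite xx !subrr sqr_enorm dot0l mulr0.
by rewrite ltxx.
Qed.

Theorem theorem5p6 (R : realType) (n l : nat) (m : 'I_l -> nat)
    (m_ge3 : forall i, (3 <= m i)%N)
    (f0 : 'rV[R]_n -> R) (F : forall i, 'rV[R]_n -> 'rV[R]_(m i))
    (f0_C2 : C2 f0) (F_C2 : forall i j, C2 (fun x => F i x 0 j))
    (xbar : 'rV[R]_n) (xbar_feasible : soc_prod m (stack F xbar))
    (second_order : forall u : 'rV[R]_n,
      critical_cone f0 (stack F) (soc_prod m) xbar u -> u <> 0 ->
      exists (alpha : R) (lam : forall i, 'rV[R]_(m i)),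
        [/\ 0 <= alpha,
            forall i, (normal_cone (soc (m i)) (F i xbar)
                       `&` orth (u *m 'J (F i) xbar)) (lam i),
            0 = alpha *: grad f0 xbar
                + \sum_(i < l) lam i *m ('J (F i) xbar)^T
          & 0 < quad (alpha *: hess f0 xbar
                      + \sum_(i < l) \sum_(j < m i)
                          lam i 0 j *: hess (fun x => F i x 0 j) xbar) u
                + \sum_(i < l | F i xbar \in bdry (soc (m i)) `\ 0)
                    enorm (lam i) / enorm (F i xbar)
                    * (tail_norm (u *m 'J (F i) xbar) ^+ 2
                       - coord1 (u *m 'J (F i) xbar) ^+ 2)]) :
  essential_local_min2 f0 (stack F) (soc_prod m) xbar.
Proof.
apply: contrapT => nmin.
(* The [k]-th pair witnesses failure for both constants equal to [1 / (k + 1)]. *)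
have [z zP] := choice (fun k : nat =>
  violating_pair xbar_feasible nmin (harmonic_gt0 k)).
pose s k := enorm ((z k).1 - xbar).
pose d k := (s k)^-1 *: ((z k).1 - xbar).
have s_gt0 k : 0 < s k by case: (zP k) => /andP[].
have d1 k : enorm (d k) = 1.
  by rewrite enormZ gtr0_norm ?invr_gt0// mulVf// gt_eqF.
have [|g [u [g_ge du]]] := @bounded_subsequence _ _ d.
  by move=> k; rewrite -(d1 k) norm_le_enorm.
have harmonic_g k : harmonic (g k) <= harmonic k :> R.
  by rewrite /harmonic lef_pV2 ?posrE// ler_nat ltnS.
pose t k := s (g k); pose v k := d (g k).
have t_gt0 k : 0 < t k by exact: s_gt0.
have t_cvg : t @ \oo --> (0 : R).
  apply: (squeeze_cvgr _ (cvg_cst 0) cvg_harmonic); apply: nearW => k.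
  rewrite ltW//=; case: (zP (g k)) => /andP[_ h] _ _ _.
  exact: le_trans h (harmonic_g k).
have xE k : xbar + t k *: v k = (z (g k)).1.
  by rewrite scalerA mulfV ?gt_eqF// scale1r addrC subrK.
have f0_le k : f0 (xbar + t k *: v k) - f0 xbar <= harmonic k * t k ^+ 2.
  rewrite xE; case: (zP (g k)) => _ h _ _; apply: le_trans h _.
  by rewrite ler_wpM2r ?sqr_ge0.
have y_near k : enorm ((z (g k)).2 - stack F (xbar + t k *: v k))
    <= harmonic k * t k ^+ 2.
  rewrite xE; case: (zP (g k)) => _ _ _ h; apply: le_trans h _.
  by rewrite ler_wpM2r ?sqr_ge0.
have yC k : soc_prod m (z (g k)).2 by case: (zP (g k)).
have u_neq0 : u <> 0.
  move=> u0; have : enorm u = 1.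
    apply: (@cvg_unique _ (@Rhausdorff R) (@fmap nat R (fun=> 1) \oo)).
      by rewrite (_ : (fun=> 1) = fun k => enorm (v k));
        [exact: cvg_enorm | apply/funext => k; rewrite d1].
    exact: cvg_cst.
  move=> /(congr1 (fun r => r ^+ 2)); rewrite u0 sqr_enorm dot0l expr1n => /eqP.
  by rewrite eq_sym oner_eq0.
have crit : critical_cone f0 (stack F) (soc_prod m) xbar u.
  exact: (critical_direction f0_C2 F_C2 t_gt0 t_cvg du cvg_harmonic yC f0_le
    y_near).
have [alpha [lam [alpha0 lamN stat pos]]] := second_order u crit u_neq0.
move: pos; rewrite ltNge => /negP; apply.
apply: (second_order_le f0_C2 F_C2 t_gt0 t_cvg du cvg_harmonic yC f0_le
  y_near) => //.
- by move=> i; apply: leq_trans (m_ge3 i).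
- by move=> i; case: (lamN i).
Qed.
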